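(* Let $d$ be any design (any $k\times b$ array with entries in $\{1,\dots,v\}$), and let $C_d$ be the information matrix for $\tau$ under the mixed model $E(Y)=X_d\tau+Z\gamma$, $V(Y)=V=\mathbf{I}_b\otimes\Sigma$, where $\Sigma\preceq \sigma_{0\varepsilon}^2\mathbf{I}_k+\sigma_{0\beta}^2\mathbf{1}_k\mathbf{1}_k'+\sigma_{0\theta}^2\phi\phi'$ (all notation as defined in the context). Then $C_d\succeq C_d^L$, where $$\sigma_{0\varepsilon}^2\, C_d^L=\sum_{j=1}^b X_{dj}'WX_{dj}-\left(\frac{1-k\lambda_0}{bk}\right)\mathbf{r}_d\mathbf{r}_d'-\left(\frac{1-\lambda_1}{b}\right)M_d\phi\phi'M_d',$$ with $W=\mathbf{I}_k-\lambda_0\mathbf{1}_k\mathbf{1}_k'-\lambda_1\phi\phi'$, $\lambda_0=\dfrac{\sigma_{0\beta}^2}{\sigma_{0\varepsilon}^2+k\sigma_{0\beta}^2}$ and $\lambda_1=\dfrac{\sigma_{0\theta}^2}{\sigma_{0\varepsilon}^2+\sigma_{0\theta}^2}$.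
   Context: Let $v,b\ge 1$ and $k\ge 2$ be integers. A design $d$ assigns treatment $d(p,j)\in\{1,\dots,v\}$ to unit $p\in\{1,\dots,k\}$ of block $j\in\{1,\dots,b\}$; it is viewed as a $k\times b$ array. $\mathbf{1}_m$ is the $m\times1$ vector of ones, $\mathbf{I}_m$ the identity matrix of order $m$, $\otimes$ the Kronecker product, and a prime denotes transpose. $\phi(p)=\sqrt{3/(k(k^2-1))}\,(2p-k-1)$ for $p=1,\dots,k$, and $\phi=(\phi(1),\dots,\phi(k))'$ (the linear orthonormal polynomial on $\{1,\dots,k\}$). For symmetric matrices, $B\succeq A$ (equivalently $A\preceq B$) means that $B-A$ is nonnegative definite (Löwner ordering). $X_{dj}$ is the $k\times v$ matrix with $X_{dj}(p,i)=1$ if $d(p,j)=i$ and $0$ otherwise; $X_d=(X_{d1}',\dots,X_{db}')'$ (size $bk\times v$); $Z=(\mathbf{1}_{bk},\ \mathbf{1}_b\otimes\phi)$ (size $bk\times2$). $\mathbf{r}_d=(r_{d1},\dots,r_{dv})'$, where $r_{di}$ is the number of cells $(p,j)$ with $d(p,j)=i$. $M_d=(m_{dip})$ is the $v\times k$ matrix with $m_{dip}$ the number of blocks $j$ with $d(p,j)=i$. Model: the observation on unit $p$ of block $j$ is $y_{pj}=\mu+\tau_{d(p,j)}+\beta_j+\theta_0\phi(p)+\theta_j\phi(p)+\delta_{pj}$, with fixed effects $\mu$, $\tau=(\tau_1,\dots,\tau_v)'$, $\theta_0$ and random effects $\beta_j,\theta_j,\delta_{pj}$ of mean zero, uncorrelated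 from one block to the next. With $\delta_j=(\delta_{1j},\dots,\delta_{kj})'$, the covariance matrix of the observations in each block is $$\Sigma=\sigma_\beta^2\mathbf{1}_k\mathbf{1}_k'+\sigma_\theta^2\phi\phi'+V_{\delta\delta}+\sigma_{\beta\theta}(\mathbf{1}_k\phi'+\phi\mathbf{1}_k')+(\mathbf{1}_kV_{\delta\beta}'+V_{\delta\beta}\mathbf{1}_k')+(\phi V_{\delta\theta}'+V_{\delta\theta}\phi'),$$ where $\sigma_\beta^2,\sigma_\theta^2$ are the variances of $\beta_j,\theta_j$, $\sigma_{\beta\theta}$ is their covariance, $V_{\delta\beta},V_{\delta\theta}$ are the $k\times 1$ vectors of covariances of $\delta_j$ with $\beta_j$ and $\theta_j$, and $V_{\delta\delta}$ is the covariance matrix of $\delta_j$. Thus $E(Y)=X_d\tau+Z\gamma$ with $\gamma=(\mu,\theta_0)'$ and $V(Y)=V=\mathbf{I}_b\otimes\Sigma$. $\Sigma$ is assumed positive definite. The information matrix for $\tau$ is $$C_d=X_d'V^{-1}X_d-X_d'V^{-1}Z(Z'V^{-1}Z)^{-1}Z'V^{-1}X_d.$$ Standing assumption: $\sigma_{0\varepsilon}^2>0$, $\sigma_{0\beta}^2\ge0$, $\sigma_{0\theta}^2\ge0$ are real constants such that $\Sigma\preceq\sigma_{0\varepsilon}^2\mathbf{I}_k+\sigma_{0\beta}^2\mathbf{1}_k\mathbf{1}_k'+\sigma_{0\theta}^2\phi\phi'$. *)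

(* Defs.v *)
From HB Require Import structures.
From mathcomp Require Import all_boot all_order all_algebra.
From mathcomp Require Import mxtens.
From mathcomp Require Import all_classical all_reals all_analysis.
From mathcomp Require Import ring.

Set Implicit Arguments.
Unset Strict Implicit.
Unset Printing Implicit Defensive.

Import Order.TTheory GRing.Theory Num.Theory.
Import numFieldNormedType.Exports.
Local Open Scope ring_scope.

Section Loewner.
Variables (R : realType) (n : nat).
Implicit Types A B : 'M[R]_n.

Definition nonneg_definite A : Prop :=
  A^T = A /\ forall x : 'cV[R]_n, 0 <= (x^T *m A *m x) 0 0.

Definition positive_definite A : Prop :=
  A^T = A /\ forall x : 'cV[R]_n, x != 0 -> 0 < (x^T *m A *m x) 0 0.

Definition loewner_le A B : Prop := nonneg_definite (B - A).

End Loewner.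

Notation "A ⪯ B" := (loewner_le A B) (at level 70, no associativity).

Definition ones (R : realType) (m : nat) : 'cV[R]_m := const_mx 1.

(* Units, blocks and treatments are numbered from 0, so unit p : 'I_k is the
   p.+1-th unit of its block. *)
Definition phi (R : realType) (k : nat) : 'cV[R]_k :=
  \col_(p < k) (Num.sqrt (3 / (k%:R * (k%:R ^+ 2 - 1)))
                * (2 * p.+1%:R - k%:R - 1)).

Definition design (v k b : nat) := 'M['I_v]_(k, b).

Section Design.
Variables (R : realType) (v k b : nat) (d : design v k b).

Definition Xblock (j : 'I_b) : 'M[R]_(k, v) :=
  \matrix_(p < k, i < v) (d p j == i)%:R.

(* The rows of a matrix with b * k rows are ordered as in a Kronecker product:
   row mxtens_index (j, p) is that of unit p of block j. *)
Definition Xmx : 'M[R]_(b * k, v) :=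
  \matrix_(u < b * k, i < v) Xblock (mxtens_unindex u).1 (mxtens_unindex u).2 i.

Definition Zmx : 'M[R]_(b * k, 1 + 1) :=
  row_mx (ones R (b * k)) (tensmx (ones R b) (phi R k) : 'cV[R]_(b * k)).

Definition replications : 'cV[R]_v :=
  \col_(i < v) #|[set pj : 'I_k * 'I_b | d pj.1 pj.2 == i]|%:R.

Definition incidence : 'M[R]_(v, k) :=
  \matrix_(i < v, p < k) #|[set j : 'I_b | d p j == i]|%:R.

Definition Vmx (Sigma : 'M[R]_k) : 'M[R]_(b * k) := tensmx (1%:M : 'M[R]_b) Sigma.

Definition information_mx (Sigma : 'M[R]_k) : 'M[R]_v :=
  let Vi := invmx (Vmx Sigma) in
  Xmx^T *m Vi *m Xmx
  - Xmx^T *m Vi *m Zmx *m invmx (Zmx^T *m Vi *m Zmx) *m Zmx^T *m Vi *m Xmx.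

End Design.

Section LowerBound.
Variables (R : realType) (v k b : nat) (d : design v k b).
(* The constants standing for the variances sigma_0^2, not the standard
   deviations. *)
Variables (s0eps2 s0beta2 s0theta2 : R).

Definition lambda0 : R := s0beta2 / (s0eps2 + k%:R * s0beta2).

Definition lambda1 : R := s0theta2 / (s0eps2 + s0theta2).

Definition Wmx : 'M[R]_k :=
  1%:M - lambda0 *: (ones R k *m (ones R k)^T)
  - lambda1 *: (phi R k *m (phi R k)^T).

Definition CL : 'M[R]_v :=
  s0eps2^-1 *:
    (\sum_(j < b) (Xblock R d j)^T *m Wmx *m Xblock R d j
     - ((1 - k%:R * lambda0) / (b%:R * k%:R)) *:
         (replications R d *m (replications R d)^T)
     - ((1 - lambda1) / b%:R) *:
         (incidence R d *m phi R k *m (phi R k)^T *m (incidence R d)^T)).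

End LowerBound.

Record mixed_model (R : realType) (v k b : nat) (disp : measure_display)
    (T : measurableType disp) (P : probability T R) := MixedModel {
  mu : R;
  tau : 'cV[R]_v;
  theta0 : R;
  beta : 'I_b -> {RV P >-> R};
  theta : 'I_b -> {RV P >-> R};
  delta : 'I_k -> 'I_b -> {RV P >-> R};
  sbeta2 : R;
  stheta2 : R;
  sbetatheta : R;
  Vdeltabeta : 'cV[R]_k;
  Vdeltatheta : 'cV[R]_k;
  Vdeltadelta : 'M[R]_k;
  beta_L2 : forall j, (beta j : T -> R) \in Lfun P 2%:E;
  theta_L2 : forall j, (theta j : T -> R) \in Lfun P 2%:E;
  delta_L2 : forall p j, (delta p j : T -> R) \in Lfun P 2%:E;
  beta_mean : forall j, ('E_P[beta j] = 0)%E;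
  theta_mean : forall j, ('E_P[theta j] = 0)%E;
  delta_mean : forall p j, ('E_P[delta p j] = 0)%E;
  (* The factor (j == j')%:R says that effects from different blocks are
     uncorrelated. *)
  cov_beta : forall j j',
    covariance P (beta j) (beta j') = ((j == j')%:R * sbeta2)%:E;
  cov_theta : forall j j',
    covariance P (theta j) (theta j') = ((j == j')%:R * stheta2)%:E;
  cov_beta_theta : forall j j',
    covariance P (beta j) (theta j') = ((j == j')%:R * sbetatheta)%:E;
  cov_delta_beta : forall p j j',
    covariance P (delta p j) (beta j') = ((j == j')%:R * Vdeltabeta p 0)%:E;
  cov_delta_theta : forall p j j',
    covariance P (delta p j) (theta j') = ((j == j')%:R * Vdeltatheta p 0)%:E;
  cov_delta : forall p q j j',
    covariance P (delta p j) (delta q j') = ((j == j')%:R * Vdeltadelta p q)%:E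
}.

Section MixedModel.
Variables (R : realType) (v k b : nat) (disp : measure_display).
Variables (T : measurableType disp) (P : probability T R).
Variables (d : design v k b) (M : mixed_model v k b P).

Definition Sigma : 'M[R]_k :=
  let one := ones R k in
  let ph := phi R k in
  sbeta2 M *: (one *m one^T) + stheta2 M *: (ph *m ph^T) + Vdeltadelta M
  + sbetatheta M *: (one *m ph^T + ph *m one^T)
  + (one *m (Vdeltabeta M)^T + Vdeltabeta M *m one^T)
  + (ph *m (Vdeltatheta M)^T + Vdeltatheta M *m ph^T).

Definition observation (p : 'I_k) (j : 'I_b) : T -> R := fun w =>
  mu M + tau M (d p j) 0 + beta M j w + theta0 M * phi R k p 0
  + theta M j w * phi R k p 0 + delta M p j w.

Definition gamma : 'cV[R]_(1 + 1) := col_mx (mu M)%:M (theta0 M)%:M.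

Let cell (p : 'I_k) (j : 'I_b) : R :=
  mu M + tau M (d p j) 0 + theta0 M * phi R k p 0.

Let effect (p : 'I_k) (j : 'I_b) : T -> R :=
  (beta M j : T -> R) \+ ((phi R k p 0) \o* (theta M j : T -> R) \+ delta M p j).

Let observationE p j : observation p j = cst (cell p j) \+ effect p j.
Proof. by apply/funext => w; rewrite /observation /cell /effect /=; ring. Qed.

Let L21 (f : T -> R) : f \in Lfun P 2%:E -> f \in Lfun P 1.
Proof. by apply: Lfun_subset12; rewrite fin_num_measure. Qed.

Let L2D (f g : T -> R) :
  f \in Lfun P 2%:E -> g \in Lfun P 2%:E -> (f \+ g) \in Lfun P 2%:E.
Proof.
have two_ge1 : (1 <= 2%:E :> \bar R)%E by rewrite lee_fin ler1n.
exact: (Lfun_addr_closed P two_ge1).2.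
Qed.

Let scaled_L2 p j : (phi R k p 0 \o* (theta M j : T -> R)) \in Lfun P 2%:E.
Proof. by apply: Lfun_scale; [rewrite ler1n | exact: theta_L2]. Qed.

Let tail_L2 p j :
  ((phi R k p 0) \o* (theta M j : T -> R) \+ delta M p j) \in Lfun P 2%:E.
Proof. by apply: L2D; [exact: scaled_L2 | exact: delta_L2]. Qed.

Let effect_L2 p j : effect p j \in Lfun P 2%:E.
Proof. by apply: L2D; [exact: beta_L2 | exact: tail_L2]. Qed.

Lemma observation_mean p j :
  'E_P[observation p j]%E =
  ((Xmx R d *m tau M + Zmx R k b *m gamma) (mxtens_index (j, p)) 0)%:E.
Proof.
rewrite observationE expectationD ?L21 ?Lfun_cst // expectation_cst.
rewrite /effect expectationD ?L21 ?beta_L2 // expectationD ?L21 ?delta_L2 //.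
rewrite expectationZl ?L21 ?theta_L2 // beta_mean theta_mean delta_mean.
rewrite mule0 !adde0; congr EFin.
rewrite !mxE (bigD1 (d p j)) //= big1 => [|i ne_i]; last first.
  by rewrite !mxE mxtens_indexK /= eq_sym (negPf ne_i) mul0r.
rewrite !mxE mxtens_indexK /= eqxx mul1r addr0 big_split_ord /= !big_ord1.
rewrite (_ : Zmx R k b _ (lshift 1 0) = 1); last by rewrite row_mxEl !mxE.
rewrite row_mxEr col_mxEu col_mxEd !mxE mxtens_indexK /= !mulr1n.
by rewrite /cell !mxE; ring.
Qed.

Let cov_scalel a (f g : T -> R) : f \in Lfun P 2%:E -> g \in Lfun P 2%:E ->
  covariance P (a \o* f) g = (a%:E * covariance P f g)%E.
Proof.
move=> f2 g2; apply: covarianceZl; [exact: L21 | exact: L21 |].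
exact: Lfun2_mul_Lfun1.
Qed.

Let cov_scaler a (f g : T -> R) : f \in Lfun P 2%:E -> g \in Lfun P 2%:E ->
  covariance P f (a \o* g) = (a%:E * covariance P f g)%E.
Proof.
move=> f2 g2; apply: covarianceZr; [exact: L21 | exact: L21 |].
exact: Lfun2_mul_Lfun1.
Qed.

Lemma observation_cov p q j j' :
  covariance P (observation p j) (observation q j') =
  (Vmx b Sigma (mxtens_index (j, p)) (mxtens_index (j', q)))%:E.
Proof.
have b2 := beta_L2 M; have t2 := theta_L2 M; have d2 := delta_L2 M.
have c2 r l : cst (cell r l) \in Lfun P 2%:E by exact: Lfun_cst.
have o2 r l : (cst (cell r l) \+ effect r l) \in Lfun P 2%:E by exact: L2D.
rewrite !observationE (covarianceDl (c2 p j) (effect_L2 p j) (o2 q j')).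
rewrite covariance_cst_l add0e.
rewrite (covarianceDr (effect_L2 p j) (c2 q j') (effect_L2 q j')).
rewrite covariance_cst_r add0e.
have covEr (f : T -> R) : f \in Lfun P 2%:E ->
    covariance P f (effect q j') =
    (covariance P f (beta M j') + (phi R k q 0)%:E * covariance P f (theta M j')
     + covariance P f (delta M q j'))%E.
  move=> f2; rewrite (covarianceDr f2 (b2 j') (tail_L2 q j')).
  by rewrite (covarianceDr f2 (scaled_L2 q j') (d2 q j')) cov_scaler // addeA.
rewrite (covarianceDl (b2 j) (tail_L2 p j) (effect_L2 q j')).
rewrite (covarianceDl (scaled_L2 p j) (d2 p j) (effect_L2 q j')).
rewrite cov_scalel // !covEr //.
rewrite (covarianceC _ (beta M j) (delta M q j')).
rewrite (covarianceC _ (theta M j) (beta M j')).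
rewrite (covarianceC _ (theta M j) (delta M q j')).
rewrite cov_beta cov_theta !cov_beta_theta !cov_delta_beta !cov_delta_theta.
rewrite cov_delta -!EFinM -!EFinD; congr EFin.
rewrite /Vmx tensmxE mxE /Sigma !mxE !big_ord1 !mxE (eq_sym j' j).
by case: eqP => _ /=; rewrite ?mulr1n ?mulr0n; ring.
Qed.

End MixedModel.

(* Main.v *)
(* With [g] the generalized least squares coefficient of [X x] on [Z], the
   quadratic form of the information matrix is x'C x = e'V^-1 e, [e] being the
   residual [X x - Z g]. Inversion reverses the Loewner order, so e'V^-1 e is at
   least its value with [Sigma] replaced by its upper bound, whose inverse is
   [W / s0eps2]. As 1 and phi are orthogonal eigenvectors of [W], the latter is
   an explicit quadratic in the two entries of [g]; completing the square gives
   x'C^L x as its minimum. *)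
Require Import Defs.
From HB Require Import structures.
From mathcomp Require Import all_boot all_order all_algebra.
From mathcomp Require Import mxtens.
From mathcomp Require Import all_classical all_reals all_analysis.
From mathcomp Require Import ring lra.

Set Implicit Arguments.
Unset Strict Implicit.
Unset Printing Implicit Defensive.

Import Order.TTheory GRing.Theory Num.Theory.
Import numFieldNormedType.Exports.
Local Open Scope ring_scope.

(** * Inner product of column vectors *)

Section InnerProduct.
Variable R : realType.

Definition dot n (x y : 'cV[R]_n) : R := (x^T *m y) 0 0.

Lemma dotE n (x y : 'cV[R]_n) : dot x y = \sum_i x i 0 * y i 0.
Proof. by rewrite /dot mxE; apply: eq_bigr => i _; rewrite mxE. Qed.

Lemma dotC n (x y : 'cV[R]_n) : dot x y = dot y x.
Proof. by rewrite !dotE; apply: eq_bigr => i _; rewrite mulrC. Qed.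

Lemma dotDr n (x y z : 'cV[R]_n) : dot x (y + z) = dot x y + dot x z.
Proof. by rewrite /dot mulmxDr mxE. Qed.

Lemma dotNr n (x y : 'cV[R]_n) : dot x (- y) = - dot x y.
Proof. by rewrite /dot mulmxN mxE. Qed.

Lemma dotZr n a (x y : 'cV[R]_n) : dot x (a *: y) = a * dot x y.
Proof. by rewrite /dot -scalemxAr mxE. Qed.

Lemma dotDl n (x y z : 'cV[R]_n) : dot (y + z) x = dot y x + dot z x.
Proof. by rewrite dotC dotDr !(dotC x). Qed.

Lemma dotNl n (x y : 'cV[R]_n) : dot (- y) x = - dot y x.
Proof. by rewrite dotC dotNr dotC. Qed.

Lemma dotZl n a (x y : 'cV[R]_n) : dot (a *: y) x = a * dot y x.
Proof. by rewrite dotC dotZr dotC. Qed.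

Lemma dot0r n (x : 'cV[R]_n) : dot x 0 = 0.
Proof. by rewrite /dot mulmx0 mxE. Qed.

Definition dot_lin := (dotDr, dotNr, dotZr, dotDl, dotNl, dotZl).

Lemma dot_sumr n (I : finType) (x : 'cV[R]_n) (y : I -> 'cV[R]_n) :
  dot x (\sum_i y i) = \sum_i dot x (y i).
Proof. by rewrite /dot mulmx_sumr summxE. Qed.

Lemma dot_mulmx m n (A : 'M[R]_(m, n)) x y : dot x (A *m y) = dot (A^T *m x) y.
Proof. by rewrite /dot trmx_mul trmxK mulmxA. Qed.

Lemma dot_outer n (x y u w : 'cV[R]_n) :
  dot x (u *m w^T *m y) = dot x u * dot w y.
Proof.
by rewrite /dot -!mulmxA mulmxA [LHS]mxE big_ord1.
Qed.

End InnerProduct.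

Lemma trmxB (R : zmodType) m n (A B : 'M[R]_(m, n)) : (A - B)^T = A^T - B^T.
Proof. exact: raddfB. Qed.

Lemma trmxZ (R : pzRingType) m n a (A : 'M[R]_(m, n)) : (a *: A)^T = a *: A^T.
Proof. exact: linearZ. Qed.

(** * Positive definite matrices and the Loewner order *)

Section LoewnerOrder.
Variables (R : realType) (n : nat).
Implicit Types A B : 'M[R]_n.

Lemma loewner_leE A B x : A ⪯ B -> dot x (A *m x) <= dot x (B *m x).
Proof.
move=> [_ /(_ x)].
by rewrite -mulmxA -/(dot x _) mulmxBl dotDr dotNr subr_ge0.
Qed.

Lemma loewner_leI A B : A^T = A -> B^T = B ->
  (forall x, dot x (A *m x) <= dot x (B *m x)) -> A ⪯ B.
Proof.
move=> symA symB leAB; split=> [|x]; first by rewrite trmxB symA symB.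
by rewrite -mulmxA -/(dot x _) mulmxBl dotDr dotNr subr_ge0.
Qed.

Lemma positive_definite_sym A : positive_definite A -> A^T = A.
Proof. by case. Qed.

Lemma positive_definite_gt0 A x :
  positive_definite A -> x != 0 -> 0 < dot x (A *m x).
Proof. by move=> [_ pdA] /pdA; rewrite -mulmxA. Qed.

Lemma positive_definite_ge0 A x : positive_definite A -> 0 <= dot x (A *m x).
Proof.
move=> pdA; have [->|x_neq0] := eqVneq x 0; first by rewrite mulmx0 dot0r.
exact/ltW/positive_definite_gt0.
Qed.

Lemma positive_definiteI A : A^T = A ->
  (forall x, x != 0 -> 0 < dot x (A *m x)) -> positive_definite A.
Proof. by move=> symA pdA; split=> // x /pdA; rewrite /dot mulmxA. Qed.

Lemma positive_definite_unitmx A : positive_definite A -> A \in unitmx.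
Proof.
move=> pdA; rewrite unitmxE unitfE; apply/negP => /det0P[w w_neq0 wA0].
have := @positive_definite_gt0 A w^T pdA.
by rewrite trmx_eq0 /dot trmxK mulmxA wA0 mul0mx mxE ltxx => /(_ w_neq0).
Qed.

Lemma trmx_invmx A : A^T = A -> (invmx A)^T = invmx A.
Proof. by move=> symA; rewrite trmx_inv symA. Qed.

Lemma positive_definite_invmx A :
  positive_definite A -> positive_definite (invmx A).
Proof.
move=> pdA; have uA := positive_definite_unitmx pdA.
apply: positive_definiteI => [|x x_neq0].
  exact/trmx_invmx/positive_definite_sym.
(* With [w = invmx A *m x], the form x'A^-1 x equals w'A w, and w is nonzero because x is. *)
rewrite -[X in dot X _](mulKVmx uA) dotC dot_mulmx.
rewrite (positive_definite_sym pdA) dotC; apply: positive_definite_gt0 => //.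
apply: contraNneq x_neq0 => Ax0.
by rewrite -(mulKVmx uA x) Ax0 mulmx0.
Qed.

(** Put u = A^-1 y and z = B^-1 y. Expanding (u - z)'A(u - z) >= 0 gives y'u - 2 y'z + z'A z >= 0,
    and z'A z <= z'B z = y'z turns this into y'z <= y'u. *)
Lemma loewner_le_invmx A B :
  positive_definite A -> A ⪯ B -> invmx B ⪯ invmx A.
Proof.
move=> pdA leAB; have symA := positive_definite_sym pdA.
(* [⪯] contains the symmetry of [B - A], so that of [A] passes to [B]. *)
have symB : B^T = B.
  by rewrite -(subrK A B) linearD /= symA leAB.1.
have pdB : positive_definite B.
  apply: positive_definiteI => // x x_neq0.
  exact: lt_le_trans (positive_definite_gt0 pdA x_neq0) (loewner_leE x leAB).
have uA := positive_definite_unitmx pdA.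
have uB := positive_definite_unitmx pdB.
apply: loewner_leI => [||y]; [exact: trmx_invmx..|].
set u := invmx A *m y; set z := invmx B *m y.
have Au : A *m u = y by rewrite /u mulKVmx.
have Bz : B *m z = y by rewrite /z mulKVmx.
have := positive_definite_ge0 (u - z) pdA.
have := loewner_leE z leAB.
have zAu : dot u (A *m z) = dot z y by rewrite dot_mulmx symA Au dotC.
rewrite Bz mulmxBr !dot_lin Au zAu !(dotC y); lra.
Qed.

End LoewnerOrder.

(** * Generalized least squares *)

Lemma positive_definite_congr (R : realType) m n (A : 'M[R]_m)
    (Z : 'M[R]_(m, n)) :
  positive_definite A -> (forall g : 'cV[R]_n, Z *m g = 0 -> g = 0) ->
  positive_definite (Z^T *m A *m Z).
Proof.
move=> pdA Zinj; apply: positive_definiteI => [|x x_neq0].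
  by rewrite !trmx_mul trmxK (positive_definite_sym pdA) mulmxA.
rewrite -!mulmxA dot_mulmx trmxK; apply: positive_definite_gt0 => //.
by apply: contraNneq x_neq0 => /Zinj ->.
Qed.

(* The residual [X x - Z g] is orthogonal to [Z] for the inner product [A]. *)
Lemma gls_residual (R : realType) m n p (A : 'M[R]_m) (X : 'M[R]_(m, n))
    (Z : 'M[R]_(m, p)) (x : 'cV[R]_n) :
  positive_definite A -> (forall g : 'cV[R]_p, Z *m g = 0 -> g = 0) ->
  exists g : 'cV[R]_p,
    dot x ((X^T *m A *m X
            - X^T *m A *m Z *m invmx (Z^T *m A *m Z) *m Z^T *m A *m X) *m x)
    = dot (X *m x - Z *m g) (A *m (X *m x - Z *m g)).
Proof.
move=> pdA Zinj; have symA := positive_definite_sym pdA.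
(* Injectivity of [Z] makes Z'AZ invertible, so the normal equations Z'AZ g = Z'AX x can be solved
   for [g]. *)
have uK := positive_definite_unitmx (positive_definite_congr pdA Zinj).
set K := Z^T *m A *m Z in uK *.
pose g := invmx K *m (Z^T *m (A *m (X *m x))); exists g.
have normal : Z^T *m (A *m (X *m x - Z *m g)) = 0.
  rewrite !mulmxBr; apply/eqP; rewrite subr_eq0; apply/eqP.
  by rewrite !(mulmxA _ _ g) (mulmxA Z^T A Z) -/K /g mulKVmx.
set e := X *m x - Z *m g in normal *.
(* By the normal equations (Zg)'Ae = 0, so e'Ae reduces to x'X'Ae; expanding this second [e] gives
   the matrix on the left. *)
rewrite [in RHS]/e dotDl dotNl [dot (Z *m g) _]dotC.
rewrite [dot _ (Z *m g)]dot_mulmx normal [dot 0 g]dotC dot0r subr0.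
rewrite [RHS]dotC [RHS]dot_mulmx [RHS]dotC; congr dot.
by rewrite mulmxBl /e /g !mulmxBr !mulmxA.
Qed.

(** * Orthogonality and norms of 1 and phi *)

Section Polynomials.
Variables (R : realType) (k : nat).
Hypothesis k_ge2 : (2 <= k)%N.

Let k_neq0 : k%:R != 0 :> R.
Proof. by rewrite pnatr_eq0 -lt0n ltnW. Qed.

(** This is where [k_ge2] matters: for k = 1 the radicand in [phi] would be a division by zero,
    hence 0, and phi would not have norm 1. *)
Let normalizer_gt0 : 0 < k%:R * (k%:R ^+ 2 - 1) :> R.
Proof.
by rewrite mulr_gt0 ?subr_gt0 ?exprn_egt1 ?ltr1n // ltr0n ltnW.
Qed.

Lemma dot_ones_ones : dot (ones R k) (ones R k) = k%:R.
Proof.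
rewrite dotE (eq_bigr (fun=> 1)) => [|p _]; last by rewrite !mxE mulr1.
by rewrite sumr_const card_ord.
Qed.

Lemma dot_ones_phi : dot (ones R k) (phi R k) = 0.
Proof.
(* The shift [a] is kept apart from the range [n] so that induction on [n] applies; at [a = n] the
   sum vanishes. *)
have sum1 n (a : R) :
    \sum_(p < n) (2 * p.+1%:R - a - 1) = n%:R * (n%:R - a).
  by elim: n => [|n IHn]; rewrite ?big_ord0 ?mul0r // big_ord_recr /= IHn; ring.
rewrite dotE (eq_bigr (fun p : 'I_k =>
    Num.sqrt (3 / (k%:R * (k%:R ^+ 2 - 1))) * (2 * p.+1%:R - k%:R - 1))).
  by rewrite -mulr_sumr sum1 subrr !mulr0.
by move=> p _; rewrite !mxE mul1r.
Qed.

Lemma dot_phi_phi : dot (phi R k) (phi R k) = 1.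
Proof.
(* Same separation of [a] from [n]; at [a = n] only the first term remains, the reciprocal of the
   squared normalizer of [phi]. *)
have sum2 n (a : R) : \sum_(p < n) (2 * p.+1%:R - a - 1) ^+ 2
    = n%:R * (n%:R ^+ 2 - 1) / 3 + n%:R * (n%:R - a) ^+ 2.
  elim: n => [|n IHn]; first by rewrite big_ord0; ring.
  by rewrite big_ord_recr /= IHn -natr1; field.
rewrite dotE (eq_bigr (fun p : 'I_k =>
    3 / (k%:R * (k%:R ^+ 2 - 1)) * (2 * p.+1%:R - k%:R - 1) ^+ 2)).
  rewrite -mulr_sumr sum2 subrr expr0n mulr0 addr0 mulrA divfK ?gt_eqF //.
  by rewrite divff ?pnatr_eq0.
move=> p _; rewrite !mxE -[in RHS](@sqr_sqrtr _ (3 / _)) ?exprMn; first by ring.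
by rewrite divr_ge0 // ltW.
Qed.

End Polynomials.

(** * Decomposition into blocks *)

Section Blocks.
Variables (R : realType) (v k b : nat).

Definition block (j : 'I_b) (e : 'cV[R]_(b * k)) : 'cV[R]_k :=
  \col_p e (mxtens_index (j, p)) 0.

Lemma blockP e f : (forall j, block j e = block j f) -> e = f.
Proof.
move=> eq_ef; apply/colP => u; case: (mxtens_indexP u) => j p.
by have /colP/(_ p) := eq_ef j; rewrite !mxE.
Qed.

Lemma blockB j e f : block j (e - f) = block j e - block j f.
Proof. by apply/colP => p; rewrite !mxE. Qed.

Lemma sum_blocks (F : 'I_(b * k) -> R) :
  \sum_u F u = \sum_j \sum_p F (mxtens_index (j, p)).
Proof.
rewrite pair_bigA (reindex (@mxtens_index b k)) /=.
  by rewrite [RHS](eq_bigr (fun jp => F (mxtens_index jp))) => [|[]].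
exists (@mxtens_unindex b k) => u _; first exact: mxtens_indexK.
exact: mxtens_unindexK.
Qed.

Lemma dot_blocks e f : dot e f = \sum_j dot (block j e) (block j f).
Proof.
rewrite dotE sum_blocks; apply: eq_bigr => j _; rewrite dotE.
by apply: eq_bigr => p _; rewrite !mxE.
Qed.

(** The Kronecker product of the identity with [A] is block diagonal; together with [dot_blocks]
    this splits its quadratic form into a sum over blocks. *)
Lemma block_Vmx j (A : 'M[R]_k) e : block j (Vmx b A *m e) = A *m block j e.
Proof.
apply/colP => p; rewrite !mxE sum_blocks (bigD1 j) //=.
rewrite [X in _ + X]big1 ?addr0 => [|i ne_ij].
  by apply: eq_bigr => q _; rewrite tensmxE !mxE eqxx mul1r.
apply: big1 => q _.
by rewrite tensmxE !mxE eq_sym (negPf ne_ij) !mul0r.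
Qed.

Lemma Vmx_mul (A B : 'M[R]_k) : Vmx b A *m Vmx b B = Vmx b (A *m B).
Proof. by rewrite /Vmx tensmx_mul mulmx1. Qed.

Lemma Vmx1 : Vmx b 1%:M = 1%:M :> 'M[R]_(b * k).
Proof.
apply/matrixP => u w; case: (mxtens_indexP u) => i p.
case: (mxtens_indexP w) => j q.
rewrite tensmxE !mxE (can_eq (@mxtens_indexK b k)) xpair_eqE mulrb.
by case: eqP; rewrite ?mul1r ?mul0r.
Qed.

Lemma invmx_Vmx (A : 'M[R]_k) :
  A \in unitmx -> invmx (Vmx b A) = Vmx b (invmx A).
Proof.
move=> uA; have VK : Vmx b A *m Vmx b (invmx A) = 1%:M.
  by rewrite Vmx_mul mulmxV // Vmx1.
have [uV _] := mulmx1_unit VK.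
by rewrite -[RHS](mulKmx uV) VK mulmx1.
Qed.

Lemma positive_definite_Vmx (A : 'M[R]_k) :
  positive_definite A -> positive_definite (Vmx b A).
Proof.
move=> pdA; apply: positive_definiteI => [|e e_neq0].
  by rewrite /Vmx trmx_tens trmx1 (positive_definite_sym pdA).
(* A nonzero block contributes strictly; the other blocks contribute nonnegative terms. *)
have /existsP[j ej_neq0] : [exists j, block j e != 0].
  apply: contraNT e_neq0; rewrite negb_exists => /forallP e0.
  apply/eqP/blockP => j; have /negPn/eqP -> := e0 j.
  by apply/colP => p; rewrite !mxE.
rewrite dot_blocks (bigD1 j) //= block_Vmx ltr_wpDr //.
  by apply: sumr_ge0 => i _; rewrite block_Vmx positive_definite_ge0.
exact: positive_definite_gt0.
Qed.

Variable d : design v k b.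

Lemma block_Xmx j x : block j (Xmx R d *m x) = Xblock R d j *m x.
Proof.
apply/colP => p; rewrite !mxE; apply: eq_bigr => i _.
by rewrite [in LHS]mxE mxtens_indexK.
Qed.

(** The two coefficients are common to all blocks, so only two scalars remain to be minimized
    over. *)
Lemma block_Zmx j (g : 'cV[R]_(1 + 1)) :
  block j (Zmx R k b *m g) = usubmx g 0 0 *: ones R k + dsubmx g 0 0 *: phi R k.
Proof.
apply/colP => p; rewrite -[in LHS](vsubmxK g) mul_row_col !mxE !big_ord1.
by rewrite !mxE mxtens_indexK /= !mul1r mulr1; congr +%R; rewrite mulrC.
Qed.

Lemma Zmx_inj (g : 'cV[R]_(1 + 1)) :
  (0 < b)%N -> (2 <= k)%N -> Zmx R k b *m g = 0 -> g = 0.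
Proof.
(* A single block suffices: its inner products with 1 and phi isolate the two entries of [g]. *)
move=> b_gt0 k_ge2 Zg0; have := block_Zmx (Ordinal b_gt0) g.
rewrite Zg0 (_ : block _ 0 = 0) => [eq0|]; last first.
  by apply/colP => p; rewrite !mxE.
have := congr1 (dot (ones R k)) eq0; have := congr1 (dot (phi R k)) eq0.
rewrite !dot0r !dot_lin [dot (phi R k) _]dotC dot_ones_phi // dot_phi_phi //.
rewrite dot_ones_ones !mulr0 mulr1 add0r addr0 => g1 /esym/eqP.
rewrite mulf_eq0 pnatr_eq0 (gtn_eqF (ltnW k_ge2)) orbF => /eqP g0.
rewrite -(vsubmxK g) [usubmx g]mx11_scalar [dsubmx g]mx11_scalar g0 -g1.
by rewrite !raddf0 col_mx0.
Qed.

Lemma replicationsE :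
  replications R d = \sum_j (Xblock R d j)^T *m ones R k.
Proof.
apply/colP => i; rewrite summxE mxE -sum1_card natr_sum big_mkcond /=.
rewrite [LHS](eq_bigr (fun pj : 'I_k * 'I_b => (d pj.1 pj.2 == i)%:R)).
  rewrite -(pair_bigA _ (fun p j => (d p j == i)%:R)) /= exchange_big /=.
  apply: eq_bigr => j _; rewrite mxE; apply: eq_bigr => p _.
  by rewrite !mxE mulr1.
by move=> pj _; rewrite inE; case: eqP.
Qed.

Lemma incidenceE : incidence R d = \sum_j (Xblock R d j)^T.
Proof.
apply/matrixP => i p; rewrite summxE mxE -sum1_card natr_sum big_mkcond /=.
by apply: eq_bigr => j _; rewrite inE !mxE; case: eqP.
Qed.

End Blocks.

(** * The matrix [W] and the lower bound *)

Section LowerBound.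
Variables (R : realType) (v k b : nat) (d : design v k b).
Variables (s0eps2 s0beta2 s0theta2 : R).
Hypotheses (b_ge1 : (1 <= b)%N) (k_ge2 : (2 <= k)%N).
Hypotheses (s0eps2_gt0 : 0 < s0eps2) (s0beta2_ge0 : 0 <= s0beta2)
  (s0theta2_ge0 : 0 <= s0theta2).

Local Notation l0 := (lambda0 k s0eps2 s0beta2).
Local Notation l1 := (lambda1 s0eps2 s0theta2).
Local Notation W := (Wmx k s0eps2 s0beta2 s0theta2).
Local Notation "'1" := (ones R k).
Local Notation ph := (phi R k).

Let Dbeta_gt0 : 0 < s0eps2 + k%:R * s0beta2.
Proof. by rewrite ltr_pwDl ?mulr_ge0. Qed.

Let Dtheta_gt0 : 0 < s0eps2 + s0theta2.
Proof. by rewrite ltr_pwDl. Qed.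

(** [1 - k l0] and [1 - l1] are the eigenvalues of [W] at 1 and phi. They weight the squares
    completed in [dot_CL_le], so their sign is needed. *)
Lemma one_sub_klambda0_ge0 : 0 <= 1 - k%:R * l0.
Proof.
rewrite (_ : _ - _ = s0eps2 / (s0eps2 + k%:R * s0beta2)); last first.
  by rewrite /lambda0; field; rewrite gt_eqF.
by rewrite divr_ge0 // ltW.
Qed.

Lemma one_sub_lambda1_ge0 : 0 <= 1 - l1.
Proof.
rewrite (_ : _ - _ = s0eps2 / (s0eps2 + s0theta2)); last first.
  by rewrite /lambda1; field; rewrite gt_eqF.
by rewrite divr_ge0 // ltW.
Qed.

Lemma Wmx_sym : W^T = W.
Proof. by rewrite /Wmx !trmxB !trmxZ trmx1 !trmx_mul !trmxK. Qed.

(** Both sides act by scalars on 1, on phi and on their orthogonal complement. The bound has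
    eigenvalues [s0eps2 + k s0beta2], [s0eps2 + s0theta2] and [s0eps2] there, and [l0], [l1] are
    what makes those of [W / s0eps2] the reciprocals. *)
Lemma invmx_upper_bound :
  invmx (s0eps2 *: 1%:M + s0beta2 *: ('1 *m '1^T) + s0theta2 *: (ph *m ph^T))
  = s0eps2^-1 *: W.
Proof.
have outer_mul (u w x y : 'cV[R]_k) :
    u *m w^T *m (x *m y^T) = dot w x *: (u *m y^T).
  rewrite -mulmxA (mulmxA w^T) [w^T *m x]mx11_scalar mul_scalar_mx.
  by rewrite -scalemxAr.
set S := _ + _ + _.
have SW : S *m (s0eps2^-1 *: W) = 1%:M.
  rewrite -scalemxAr /S /Wmx !mulmxBr !mulmxDl -!scalemxAl -!scalemxAr !mulmx1.
  rewrite !mul1mx !outer_mul (dotC ph '1) dot_ones_ones dot_ones_phi //.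
  rewrite dot_phi_phi //; apply/matrixP => p q; rewrite !mxE /lambda0 /lambda1.
  by field; rewrite !gt_eqF.
have [uS _] := mulmx1_unit SW.
by rewrite -[RHS](mulKmx uS) SW mulmx1.
Qed.

Lemma dot_Wmx x y :
  dot x (W *m y) = dot x y - l0 * (dot '1 x * dot '1 y)
                   - l1 * (dot ph x * dot ph y).
Proof.
rewrite /Wmx !mulmxBl -!scalemxAl mul1mx !dot_lin !dot_outer.
by rewrite (dotC x '1) (dotC x ph).
Qed.

(** Orthogonality of 1 and phi removes the cross term in [a * c], so the two coefficients can be
    minimized separately. *)
Lemma dot_Wmx_residual x (a c : R) :
  let e := x - (a *: '1 + c *: ph) in
  dot e (W *m e) = dot x (W *m x)
    - (1 - k%:R * l0) * (2 * a * dot '1 x - k%:R * a ^+ 2)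
    - (1 - l1) * (2 * c * dot ph x - c ^+ 2).
Proof.
rewrite /= !dot_Wmx !dot_lin (dotC x '1) (dotC x ph) (dotC ph '1).
rewrite dot_ones_ones dot_ones_phi // dot_phi_phi //; ring.
Qed.

(** Writing r'x and phi'M'x as sums over blocks makes this comparable with the sum of the blockwise
    forms of [dot_Wmx_residual]. *)
Lemma dot_CL x :
  dot x (CL d s0eps2 s0beta2 s0theta2 *m x) = s0eps2^-1 *
    (\sum_j dot (Xblock R d j *m x) (W *m (Xblock R d j *m x))
     - (1 - k%:R * l0) / (b%:R * k%:R)
       * (\sum_j dot '1 (Xblock R d j *m x)) ^+ 2
     - (1 - l1) / b%:R * (\sum_j dot ph (Xblock R d j *m x)) ^+ 2).
Proof.
have dot_r : dot x (replications R d) = \sum_j dot '1 (Xblock R d j *m x).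
  rewrite replicationsE dot_sumr; apply: eq_bigr => j _.
  by rewrite dot_mulmx trmxK dotC.
have dot_M : dot x (incidence R d *m ph) = \sum_j dot ph (Xblock R d j *m x).
  rewrite incidenceE mulmx_suml dot_sumr; apply: eq_bigr => j _.
  by rewrite dot_mulmx trmxK dotC.
have dot_X : dot x ((\sum_j (Xblock R d j)^T *m W *m Xblock R d j) *m x)
    = \sum_j dot (Xblock R d j *m x) (W *m (Xblock R d j *m x)).
  rewrite mulmx_suml dot_sumr; apply: eq_bigr => j _.
  by rewrite -!mulmxA dot_mulmx trmxK.
rewrite /CL -scalemxAl dotZr !mulmxBl !(dotDr, dotNr) -!scalemxAl !dotZr dot_X.
rewrite dot_outer -(mulmxA _ ph^T) -trmx_mul dot_outer.
by rewrite !(dotC _ x) dot_r dot_M !expr2.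
Qed.

Lemma CL_sym : (CL d s0eps2 s0beta2 s0theta2)^T = CL d s0eps2 s0beta2 s0theta2.
Proof.
rewrite /CL; move: ((1 - k%:R * l0) / _) ((1 - l1) / _) => u w.
rewrite trmxZ !trmxB !trmxZ raddf_sum /= !trmx_mul !trmxK !mulmxA.
congr (_ *: (_ - _ - _)); apply: eq_bigr => j _.
by rewrite !trmx_mul trmxK Wmx_sym mulmxA.
Qed.

Lemma information_mx_sym (Sigma : 'M[R]_k) :
  Sigma^T = Sigma -> (information_mx d Sigma)^T = information_mx d Sigma.
Proof.
move=> symS; rewrite /information_mx; set Vi := invmx _.
have symVi : Vi^T = Vi by rewrite trmx_invmx // /Vmx trmx_tens trmx1 symS.
rewrite trmxB !trmx_mul !trmxK symVi trmx_invmx ?mulmxA //.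
by rewrite !trmx_mul trmxK symVi mulmxA.
Qed.

Lemma complete_square (n a r : R) :
  n != 0 -> n * (a - r / n) ^+ 2 = n * a ^+ 2 - 2 * a * r + r ^+ 2 / n.
Proof. by move=> n_neq0; field. Qed.

(* The right-hand side minus the left-hand side is [s0eps2^-1] times
   [(1 - k l0) b k (a - r'x/(bk))^2 + (1 - l1) b (c - ph'M'x/b)^2]. *)
Lemma dot_CL_le x (a c : R) :
  dot x (CL d s0eps2 s0beta2 s0theta2 *m x) <=
  \sum_j (let e := Xblock R d j *m x - (a *: '1 + c *: ph) in
          dot e ((s0eps2^-1 *: W) *m e)).
Proof.
have sum_cst (z : R) : \sum_(j < b) z = b%:R * z.
  by rewrite sumr_const card_ord mulr_natl.
under eq_bigr do rewrite /= -scalemxAl dotZr dot_Wmx_residual.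
rewrite -mulr_sumr dot_CL ler_pM2l ?invr_gt0 // !sumrB -!mulr_sumr !sumrB.
rewrite -!mulr_sumr !sum_cst -subr_ge0.
set r := \sum_j dot '1 _; set m := \sum_j dot ph _; set X := \sum_j _.
have b_neq0 : b%:R != 0 :> R by rewrite pnatr_eq0 -lt0n.
have k_neq0 : k%:R != 0 :> R by rewrite pnatr_eq0 -lt0n ltnW.
rewrite (_ : _ - _ =
    (1 - k%:R * l0) * (b%:R * k%:R * (a - r / (b%:R * k%:R)) ^+ 2)
    + (1 - l1) * (b%:R * (c - m / b%:R) ^+ 2)).
  rewrite addr_ge0 // mulr_ge0 ?one_sub_klambda0_ge0 ?one_sub_lambda1_ge0 //.
    by rewrite -natrM mulr_ge0 ?sqr_ge0.
  by rewrite mulr_ge0 ?sqr_ge0.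
by rewrite !complete_square ?mulf_neq0 //; ring.
Qed.

Lemma CL_le_information_mx (Sigma : 'M[R]_k) : positive_definite Sigma ->
  Sigma ⪯ s0eps2 *: 1%:M + s0beta2 *: ('1 *m '1^T) + s0theta2 *: (ph *m ph^T) ->
  CL d s0eps2 s0beta2 s0theta2 ⪯ information_mx d Sigma.
Proof.
move=> pdS leS; have uS := positive_definite_unitmx pdS.
have pdVi : positive_definite (Vmx b (invmx Sigma)).
  exact/positive_definite_Vmx/positive_definite_invmx.
have Zinj (g : 'cV[R]_(1 + 1)) : Zmx R k b *m g = 0 -> g = 0 by exact: Zmx_inj.
apply: loewner_leI => [||x]; first exact: CL_sym.
  exact/information_mx_sym/positive_definite_sym.
have [g Cx] := gls_residual (Xmx R d) x pdVi Zinj.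
rewrite /information_mx invmx_Vmx // Cx dot_blocks.
(* The bound holds for every pair of coefficients, in particular for the entries of the least
   squares [g] under [Sigma], which need not minimize the form of [W]. *)
apply: le_trans (dot_CL_le x (usubmx g 0 0) (dsubmx g 0 0)) _.
(* In each block both sides are forms in the same residual, so comparing the two inverse matrices is
   enough. *)
apply: ler_sum => j _; rewrite block_Vmx blockB block_Xmx block_Zmx /=.
rewrite -invmx_upper_bound; apply: loewner_leE.
exact: loewner_le_invmx.
Qed.

End LowerBound.

Theorem theorem2p2 (R : realType) (v k b : nat)
    (v_ge1 : (1 <= v)%N) (b_ge1 : (1 <= b)%N) (k_ge2 : (2 <= k)%N)
    (d : design v k b)
    (disp : measure_display) (T : measurableType disp) (P : probability T R)
    (M : mixed_model v k b P)
    (Sigma_posdef : positive_definite (Sigma M))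
    (s0eps2 s0beta2 s0theta2 : R)
    (s0eps2_gt0 : 0 < s0eps2) (s0beta2_ge0 : 0 <= s0beta2)
    (s0theta2_ge0 : 0 <= s0theta2)
    (Sigma_le : Sigma M ⪯ s0eps2 *: 1%:M + s0beta2 *: (ones R k *m (ones R k)^T)
                          + s0theta2 *: (phi R k *m (phi R k)^T)) :
  CL d s0eps2 s0beta2 s0theta2 ⪯ information_mx d (Sigma M).
Proof. exact: CL_le_information_mx. Qed.
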